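(* Let $V$ be a truth value set, $\triangleright$ a total order on $V$, and $\widehat{R}$ a modification operator corresponding to the choice operator $\breve{R}$ with respect to $\triangleright$. If $\phi,\psi$ are formulas and $v$ is a valuation with $v(\phi)\triangleright v(\psi)$, then $v(\widehat{R}(\psi))\triangleright v(\widehat{R}(\phi))$.
   Context: A truth value set is a set $V\subseteq[0,1]$ with $\{0,1\}\subseteq V$ and $1-v\in V$ for every $v\in V$. An $n$-adic truth function operator is a map $V^n\to V$. Formulas are built from propositional variables using truth function operators. A valuation $v$ assigns to each formula a value in $V$ homomorphically: $v(R(\phi_1,\dots,\phi_n))=R(v(\phi_1),\dots,v(\phi_n))$. For a total order $\triangleright$ on $V$, an element $x$ and a nonempty set $Y\subseteq V$, write $x\triangleright Y$ if $x\triangleright y$ for all $y\in Y$, and $Y\triangleright x$ if $y\triangleright x$ for all $y\in Y$. A choice operator with respect to $\triangleright$ is an operator $\breve{R}:V^n\to V$ with $n\ge 2$ such that $v(\breve{R}(\phi_1,\dots,\phi_n))=v(\phi_i)$ where $v(\phi_i)\triangleright\{v(\phi_j)\mid j\ne i\}$ (i.e. it returns the $\triangleright$-greatest argument). A modification operator corresponding to $\breve{R}$ is an operator $\widehat{R}:V\to V$ such that whenever $v(\breve{R}(\phi_1,\dots,\phi_n))=v(\phi_i)$ and $v(\phi_i)\triangleright\{v(\phi_j)\mid j\neq i\}$, one has $\{v(\widehat{R}(\phi_j))\mid j\ne i\}\triangleright v(\widehat{R}(\phi_i))$ and $v(\widehat{R}(\widehat{R}(\phi_i)))=v(\phi_i)$.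 *)

(* Defs.v *)
From HB Require Import structures.
From mathcomp Require Import all_boot all_order all_algebra.
From mathcomp Require Import all_classical all_reals.
Set Implicit Arguments.
Unset Strict Implicit.
Unset Printing Implicit Defensive.
Import Order.TTheory GRing.Theory Num.Theory.
Local Open Scope classical_set_scope.
Local Open Scope ring_scope.

Definition truth_value_set (R : realType) (V : set R) : Prop :=
  [/\ V `<=` [set x | 0 <= x <= 1], V 0, V 1 & forall x, V x -> V (1 - x)].

(* Non-strict: [gt x y] is to be read like "x >= y". *)
Definition total_order (T : Type) (gt : rel T) : Prop :=
  [/\ reflexive gt, antisymmetric gt, transitive gt & total gt].

Definition elt_gt_set (T : Type) (gt : rel T) (x : T) (Y : set T) : Prop :=
  forall y, Y y -> gt x y.

Definition set_gt_elt (T : Type) (gt : rel T) (Y : set T) (x : T) : Prop :=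
  forall y, Y y -> gt y x.

Definition operator (T : Type) (n : nat) : Type := {ffun 'I_n -> T} -> T.

(* Every truth function is its own connective. *)
Inductive formula (P T : Type) : Type :=
| Var of P
| App n of operator T n & {ffun 'I_n -> formula P T}.

Definition App1 (P T : Type) (r : operator T 1) (phi : formula P T) :
  formula P T := App r [ffun=> phi].

Definition valuation (P T : Type) (v : formula P T -> T) : Prop :=
  forall (n : nat) (r : operator T n) (phi : {ffun 'I_n -> formula P T}),
    v (App r phi) = r [ffun i => v (phi i)].

Definition other_values (P T : Type) (v : formula P T -> T) (n : nat)
    (phi : {ffun 'I_n -> formula P T}) (i : 'I_n) : set T :=
  [set v (phi j) | j in [set j | j != i]].

Definition choice_operator (P T : Type) (gt : rel T) (n : nat)
    (rc : operator T n) : Prop :=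
  (2 <= n)%N /\
  forall (v : formula P T -> T), valuation v ->
  forall (phi : {ffun 'I_n -> formula P T}) (i : 'I_n),
    elt_gt_set gt (v (phi i)) (other_values v phi i) ->
    v (App rc phi) = v (phi i).

Definition modification_operator (P T : Type) (gt : rel T) (n : nat)
    (rc : operator T n) (rm : operator T 1) : Prop :=
  forall (v : formula P T -> T), valuation v ->
  forall (phi : {ffun 'I_n -> formula P T}) (i : 'I_n),
    v (App rc phi) = v (phi i) ->
    elt_gt_set gt (v (phi i)) (other_values v phi i) ->
    set_gt_elt gt (other_values v [ffun j => App1 rm (phi j)] i)
      (v (App1 rm (phi i))) /\
    v (App1 rm (App1 rm (phi i))) = v (phi i).

(* Main.v *)
Require Import Defs.
From mathcomp Require Import all_boot all_order all_algebra.
From mathcomp Require Import all_classical all_reals.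

(** Feed the choice operator a tuple with [phi] in one slot and [psi] in all the others. Since
    [v phi] dominates, the operator returns it, and the defining property of [rm] then puts the
    modified [phi] below every other modified argument, hence below the modified [psi]. *)

Theorem theorem1 (R : realType) (V : set R) (hV : truth_value_set V)
    (gt : rel V) (hgt : total_order gt)
    (P : Type) (n : nat) (rc : operator V n) (rm : operator V 1)
    (hrc : choice_operator P gt rc)
    (hrm : modification_operator P gt rc rm)
    (phi psi : formula P V) (v : formula P V -> V) (hv : valuation v)
    (h : gt (v phi) (v psi)) :
  gt (v (App1 rm psi)) (v (App1 rm phi)).
Proof.
case: hrc => n_ge2 choiceE.
case: n n_ge2 rc hrm choiceE => [|[|n]] // _ rc hrm choiceE.
(* The tuple (phi, psi, ..., psi) makes phi the chosen argument. *)
pose f : {ffun 'I_n.+2 -> formula P V} :=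
  [ffun i => if i == ord0 then phi else psi].
have f0 : f ord0 = phi by rewrite ffunE eqxx.
have fN0 j : j != ord0 -> f j = psi by rewrite ffunE => /negbTE ->.
have phi_top : elt_gt_set gt (v (f ord0)) (other_values v f ord0).
  by move=> _ [j /= j_neq0 <-]; rewrite f0 fN0.
have [rm_bot _] := hrm v hv f ord0 (choiceE v hv f ord0 phi_top) phi_top.
rewrite -f0; apply: rm_bot.
(* Arity at least 2 makes [ord_max] differ from [ord0], so [psi] does occur among the other
   arguments. *)
by exists ord_max => //=; rewrite ffunE fN0.
Qed.
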